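(* For every integer $n\ge 0$, $$F_n(112;q,r,s,1)=F_n(122;q,s,r,1).$$
   Context: A restricted growth function (RGF) of length $n$ is a sequence $w=w_1\dots w_n$ of positive integers with $w_1=1$ and $w_i\le 1+\max\{w_1,\dots,w_{i-1}\}$ for $i\ge 2$ ($R_0$ consists of the empty word); $R_n$ is the set of RGFs of length $n$. The standardization of a word replaces every occurrence of its smallest letter by $1$, of its next smallest letter by $2$, and so on. An RGF $w$ contains an RGF $v$ if some subword (subsequence, not necessarily consecutive) of $w$ standardizes to $v$; otherwise $w$ avoids $v$. $R_n(v)$ is the set of $w\in R_n$ avoiding $v$. For a word $w$ and position $j$: $\mathrm{lb}(w_j)$ (resp. $\mathrm{ls}(w_j)$) is the number of distinct values $w_i$ with $i<j$ and $w_i>w_j$ (resp. $w_i<w_j$); $\mathrm{rb}(w_j)$ (resp. $\mathrm{rs}(w_j)$) is the number of distinct values $w_i$ with $i>j$ and $w_i>w_j$ (resp. $w_i<w_j$); each statistic of $w$ is the sum over $j$. Then $F_n(v;q,r,s,t)=\sum_{w\in R_n(v)}q^{\mathrm{lb}(w)}r^{\mathrm{ls}(w)}s^{\mathrm{rb}(w)}t^{\mathrm{rs}(w)}$. *)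

(* Defs.v *)
From mathcomp Require Import all_boot all_order all_algebra.

Set Implicit Arguments.
Unset Strict Implicit.
Unset Printing Implicit Defensive.

Import GRing.Theory.

(* Words are sequences of natural numbers; positions are numbered from 0, so
   that the letter w_(j+1) of the mathematical notation is [nth 0 w j]. *)

Definition is_rgf (w : seq nat) : bool :=
  [&& all (leq 1) w,
      (0 < size w) ==> (nth 0 w 0 == 1)
    & [forall i : 'I_(size w),
        (0 < i) ==> (nth 0 w i <= 1 + \max_(x <- take i w) x)]].

Definition standardization (w : seq nat) : seq nat :=
  [seq (index x (sort leq (undup w))).+1 | x <- w].

(* The subwords of w are the words [mask m w], for m a bit vector selecting
   a set of positions of w. *)
Definition contains (w v : seq nat) : bool :=
  [exists m : (size w).-tuple bool, standardization (mask m w) == v].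

Definition avoids (w v : seq nat) : bool := ~~ contains w v.

Definition distinct (s : seq nat) : nat := size (undup s).

Definition lb (w : seq nat) : nat :=
  \sum_(j < size w) distinct [seq x <- take j w | x > nth 0 w j].

Definition ls (w : seq nat) : nat :=
  \sum_(j < size w) distinct [seq x <- take j w | x < nth 0 w j].

Definition rb (w : seq nat) : nat :=
  \sum_(j < size w) distinct [seq x <- drop j.+1 w | x > nth 0 w j].

Definition rs (w : seq nat) : nat :=
  \sum_(j < size w) distinct [seq x <- drop j.+1 w | x < nth 0 w j].

(* The letters of an RGF of length n are at most n (see [rgf_in_range]), so the
   tuples over {0, ..., n} include all RGFs of length n. *)
Definition word (n : nat) (w : n.-tuple 'I_n.+1) : seq nat :=
  [seq val x | x <- w].

Definition R_ (n : nat) (v : seq nat) : {set n.-tuple 'I_n.+1} :=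
  [set w | is_rgf (word w) && avoids (word w) v].

(* The variables q, r, s, t are arbitrary elements of an arbitrary commutative
   ring; indeterminates are the case where A is a polynomial ring. *)
Definition F (A : comNzRingType) (n : nat) (v : seq nat) (q r s t : A) : A :=
  (\sum_(w in R_ n v)
     q ^+ lb (word w) * r ^+ ls (word w) * s ^+ rb (word w) * t ^+ rs (word w))%R.

Lemma rgf_le_size (w : seq nat) : is_rgf w -> all (fun x => x <= size w) w.
Proof.
case/and3P=> _ /implyP w1 /forallP w_le.
suff bd i : i < size w -> nth 0 w i <= i.+1.
  by apply/(all_nthP 0) => i lt_i; apply: leq_trans (bd i lt_i) lt_i.
elim/ltn_ind: i => -[_ lt0|i IH lt_i]; first by rewrite (eqP (w1 lt0)).
have /= le_i := w_le (Ordinal lt_i); apply: leq_trans le_i _.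
rewrite add1n ltnS; apply/bigmax_leqP_seq => x /(nthP 0)[j].
rewrite size_takel ?(ltnW lt_i) // => lt_j <- _.
rewrite nth_take //; apply: leq_trans (IH j lt_j (ltn_trans lt_j lt_i)) lt_j.
Qed.

Lemma rgf_in_range (n : nat) (w : seq nat) :
  is_rgf w -> size w = n -> exists u : n.-tuple 'I_n.+1, word u = w.
Proof.
move=> /rgf_le_size w_le <-.
exists (map_tuple inord (in_tuple w)).
rewrite /word /= -map_comp map_id_in // => x x_w /=.
by rewrite inordK // ltnS (allP w_le).
Qed.

Lemma word_inj (n : nat) : injective (@word n).
Proof. by move=> u v /(inj_map val_inj)/val_inj. Qed.

(* Main.v *)
(* An RGF avoiding 112 is 1 2 ... m followed by a weakly decreasing word; one
   avoiding 122 is 1 2 ... m with extra 1s inserted after the first letter.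
   Match the word whose decreasing tail has d_i copies of m+1-i with the word
   having d_i extra 1s right after the letter i.  Both have
   lb = sum_i (i-1) d_i, the ls of the first and the rb of the second are
   m(m-1)/2 + sum_i (m-i) d_i, and the rb of the first and the ls of the second
   are m(m-1)/2.  Setting t = 1 discards rs, which is not preserved. *)

Require Import Defs.
From mathcomp Require Import all_boot all_order all_algebra.
From mathcomp Require Import zify.

Set Implicit Arguments.
Unset Strict Implicit.
Unset Printing Implicit Defensive.

Import GRing.Theory.

(** * Restricted growth under adding letters at either end *)

(** The first-letter condition is absorbed: the maximum of the empty prefix is 0, so the bound at
    position 0 forces the letter 1. *)
Lemma rgfP (w : seq nat) :
  reflect (forall i, i < size w ->
             0 < nth 0 w i <= (\max_(x <- take i w) x).+1)
          (is_rgf w).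
Proof.
apply: (iffP and3P) => [[/(all_nthP 0) w_gt0 /implyP w1 /forallP w_le] i lt_i|w_le].
  rewrite w_gt0 //=; case: i lt_i => [|i] lt_i; first by rewrite (eqP (w1 lt_i)).
  exact: (w_le (Ordinal lt_i)).
split; first by apply/(all_nthP 0) => i /w_le/andP[].
  apply/implyP => /w_le; rewrite take0 big_nil; lia.
by apply/forallP => i; apply/implyP => _; have /andP[] := w_le i (ltn_ord i).
Qed.

Lemma rgf_rcons (w : seq nat) (x : nat) :
  is_rgf (rcons w x) = is_rgf w && (0 < x <= (\max_(y <- w) y).+1).
Proof.
apply/rgfP/andP => [wx_le|[/rgfP w_le x_le] i].
  split.
    apply/rgfP => i lt_i; have := wx_le i.
    rewrite size_rcons nth_rcons lt_i -cats1 takel_cat ?(ltnW lt_i) //.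
    by apply; apply: ltnW.
  have := wx_le (size w); rewrite size_rcons nth_rcons ltnn eqxx -cats1.
  by rewrite take_size_cat //; apply.
rewrite size_rcons ltnS leq_eqVlt => /predU1P[->|lt_i].
  by rewrite nth_rcons ltnn eqxx -cats1 take_size_cat.
by rewrite nth_rcons lt_i -cats1 takel_cat ?(ltnW lt_i) // w_le.
Qed.

Lemma rgf_nil : is_rgf [::].
Proof. by apply/rgfP. Qed.

Lemma rgf_head (x : nat) (w : seq nat) : is_rgf (x :: w) -> x = 1.
Proof. by move=> /rgfP/(_ 0 isT); rewrite take0 big_nil /=; lia. Qed.

Lemma rgf_gt0 (w : seq nat) : is_rgf w -> all (leq 1) w.
Proof. by case/and3P. Qed.

Lemma rcons_nseq1 (k : nat) : rcons (nseq k 1) 1 = nseq k.+1 1.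
Proof. by rewrite -cats1 -[[:: 1]]/(nseq 1 1) -nseqD addn1. Qed.

Lemma rgf_nseq1 (w : seq nat) (k : nat) : is_rgf (w ++ nseq k 1) = is_rgf w.
Proof.
elim: k => [|k IHk]; first by rewrite cats0.
by rewrite -rcons_nseq1 -rcons_cat rgf_rcons IHk andbT.
Qed.

Lemma bigmax_map_succ (w : seq nat) :
  \max_(x <- 1 :: map succn w) x = (\max_(x <- w) x).+1.
Proof.
rewrite big_cons big_map; elim: w => [|x w IHw]; rewrite ?big_nil ?big_cons //.
lia.
Qed.

(** Shifting up behind a leading 1 raises every prefix maximum by exactly one, so the bounds
    correspond. Positivity is stated apart because a letter 0 of [w] would become a legal 1. *)
Lemma rgf_map_succ (w : seq nat) :
  is_rgf (1 :: map succn w) && all (leq 1) w = is_rgf w.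
Proof.
elim/last_ind: w => [|w x IHw].
  by rewrite -[[:: 1]]/(rcons [::] 1) rgf_rcons big_nil rgf_nil.
rewrite map_rcons -rcons_cons !rgf_rcons bigmax_map_succ -IHw all_rcons ltnS.
by case: (is_rgf _); case: (all _ _); rewrite ?andbT ?andbF //= andbC.
Qed.

(** * Occurrences of 112 and 122 *)

(** The new letters are ranks in a strictly increasing list. This recovers the order of unknown
    letters from their known standardization. *)
Lemma standardization_mono (s : seq nat) (i j : nat) :
  i < size s -> j < size s ->
  (nth 0 (standardization s) i < nth 0 (standardization s) j)
    = (nth 0 s i < nth 0 s j).
Proof.
move=> lt_i lt_j; rewrite !(nth_map 0) // ltnS.
set S := sort _ _.
have S_leq : sorted leq S by apply: sort_sorted; apply: leq_total.
have S_ltn : sorted ltn S by rewrite ltn_sorted_uniq_leq sort_uniq undup_uniq.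
have memS x : x \in s -> x \in S by rewrite mem_sort mem_undup.
have Si := memS _ (mem_nth 0 lt_i); have Sj := memS _ (mem_nth 0 lt_j).
apply/idP/idP; first exact: (sorted_ltn_index ltn_trans).
by apply: contraTT; rewrite -!leqNgt; apply: (sorted_leq_index leq_trans leqnn).
Qed.

Lemma containsP (w v : seq nat) :
  reflect (exists2 u, subseq u w & standardization u = v) (contains w v).
Proof.
apply: (iffP existsP) => [[m /eqP <-]|[u /subseqP[m sz_m ->] <-]].
  by exists (mask m w); rewrite ?mask_subseq.
by exists (Tuple (introT eqP sz_m)).
Qed.

Lemma contains112P (w : seq nat) :
  reflect (exists a b, a < b /\ subseq [:: a; a; b] w) (contains w [:: 1; 1; 2]).
Proof.
apply: (iffP (containsP _ _)) => [[u u_w std_u]|[a [b [lt_ab ab_w]]]].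
  have mono := standardization_mono (s := u); rewrite std_u in mono.
  have := size_map (fun x => (index x (sort leq (undup u))).+1) u.
  rewrite -/(standardization u) std_u.
  case: u u_w mono {std_u} => [|x [|y [|z []]]] //= xyz_w mono _.
  (* Equality of the first two letters is read off from the failure of both strict comparisons. *)
  have [/esym yx /esym xy /esym xz] :=
    And3 (mono 1 0 isT isT) (mono 0 1 isT isT) (mono 0 2 isT isT).
  move: yx xy xz => /= yx xy xz.
  have eq_xy : x = y by lia.
  by exists x, z; split; [lia | rewrite {2}eq_xy].
exists [:: a; a; b] => //.
rewrite /standardization /= !inE eqxx /= (ltn_eqF lt_ab) /sort /=.
by rewrite (ltnW lt_ab) /= eqxx (ltn_eqF lt_ab) eqxx.
Qed.

Lemma contains122P (w : seq nat) :
  reflect (exists a b, a < b /\ subseq [:: a; b; b] w) (contains w [:: 1; 2; 2]).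
Proof.
apply: (iffP (containsP _ _)) => [[u u_w std_u]|[a [b [lt_ab ab_w]]]].
  have mono := standardization_mono (s := u); rewrite std_u in mono.
  have := size_map (fun x => (index x (sort leq (undup u))).+1) u.
  rewrite -/(standardization u) std_u.
  case: u u_w mono {std_u} => [|x [|y [|z []]]] //= xyz_w mono _.
  have [/esym yz /esym zy /esym xz] :=
    And3 (mono 1 2 isT isT) (mono 2 1 isT isT) (mono 0 2 isT isT).
  move: yz zy xz => /= yz zy xz.
  have eq_yz : y = z by lia.
  by exists x, z; split; [lia | rewrite -{1}eq_yz].
exists [:: a; b; b] => //.
rewrite /standardization /= !inE eqxx /= (ltn_eqF lt_ab) /sort /=.
by rewrite (ltnW lt_ab) /= eqxx (ltn_eqF lt_ab) eqxx.
Qed.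

(** * The two families of words *)

(* The vectors list the d_i from i = m down to i = 1, so that consing k extends
   the first word to 1 (w + 1) 1^k and the second to w (m+1) 1^k. *)
Fixpoint word112 (c : seq nat) : seq nat :=
  if c is k :: c' then 1 :: map succn (word112 c') ++ nseq k 1 else [::].

Fixpoint word122 (c : seq nat) : seq nat :=
  if c is k :: c' then word122 c' ++ (size c').+1 :: nseq k 1 else [::].

Lemma size_word112 (c : seq nat) : size (word112 c) = size c + sumn c.
Proof.
by elim: c => //= k c IHc; rewrite size_cat size_map size_nseq IHc; lia.
Qed.

Lemma size_word122 (c : seq nat) : size (word122 c) = size c + sumn c.
Proof. by elim: c => //= k c IHc; rewrite size_cat /= size_nseq IHc; lia. Qed.

Lemma mem_map_succ (s : seq nat) (x : nat) :
  (x \in map succn s) = (0 < x) && (x.-1 \in s).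
Proof.
case: x => [|x] /=; last by rewrite mem_map //; apply: succn_inj.
by apply/negbTE/negP => /mapP[].
Qed.

Lemma mem_word112 (c : seq nat) (x : nat) : (x \in word112 c) = (0 < x <= size c).
Proof.
elim: c x => [|k c IHc] x /=; first by rewrite in_nil; lia.
by rewrite inE mem_cat mem_map_succ IHc mem_nseq; lia.
Qed.

Lemma mem_word122 (c : seq nat) (x : nat) : (x \in word122 c) = (0 < x <= size c).
Proof.
elim: c x => [|k c IHc] x /=; first by rewrite in_nil; lia.
by rewrite mem_cat inE IHc mem_nseq; lia.
Qed.

Lemma bigmax_word122 (c : seq nat) : \max_(x <- word122 c) x = size c.
Proof.
elim: c => [|k c IHc] /=; first by rewrite big_nil.
rewrite big_cat big_cons /= IHc big_nseq; elim: k => [|k IHk] //=; lia.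
Qed.

Lemma rgf_word112 (c : seq nat) : is_rgf (word112 c).
Proof.
elim: c => [|k c IHc] /=; first exact: rgf_nil.
by move: IHc; rewrite -cat_cons rgf_nseq1 -rgf_map_succ => /andP[].
Qed.

Lemma rgf_word122 (c : seq nat) : is_rgf (word122 c).
Proof.
elim: c => [|k c IHc] /=; first exact: rgf_nil.
by rewrite -cat1s catA rgf_nseq1 cats1 rgf_rcons IHc bigmax_word122 /= leqnn.
Qed.

(** * Both families avoid their patterns *)

Lemma filter_nseq1 (k x : nat) : 0 < x -> [seq y <- nseq k 1 | y > x] = [::].
Proof. by move=> x_gt0; elim: k => //= k ->; case: ltnP => //; lia. Qed.

Lemma filter_map_succ (s : seq nat) :
  all (leq 1) s -> [seq x <- map succn s | x > 1] = map succn s.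
Proof. by move=> s_gt0; apply/all_filterP; rewrite all_map. Qed.

Lemma subseq_cat_notin (x : nat) (s u v : seq nat) :
  x \notin u -> subseq (x :: s) (u ++ v) -> subseq (x :: s) v.
Proof.
elim: u => // y u IHu; rewrite inE negb_or cat_cons => /andP[/negbTE x_y x_u].
by rewrite /= x_y; apply: IHu.
Qed.

Lemma subseq_map_succ (s t : seq nat) :
  subseq (map succn s) (map succn t) = subseq s t.
Proof.
elim: t s => [|y t IHt] [|x s] //=; rewrite eqSS.
by case: eqP => _; rewrite -IHt.
Qed.

Lemma avoids_word112 (c : seq nat) : avoids (word112 c) [:: 1; 1; 2].
Proof.
elim: c => [|k c IHc]; apply/contains112P => -[a [b [lt_ab ab_w]]] //.
have c_gt0 : all (leq 1) (word112 c) by apply: rgf_gt0; apply: rgf_word112.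
have : a \in word112 (k :: c) by apply: (mem_subseq ab_w); rewrite mem_head.
rewrite mem_word112 => /andP[a_gt0 _].
(* If [a] exceeds 1, the occurrence lies among the letters above 1, a shifted copy of [word112 c],
   and induction applies. If [a] is 1, its second copy lies in the final block, where nothing larger
   follows. *)
case: (ltnP 1 a) => [a_gt1|a_le1].
  have : subseq [:: a; a; b] [seq x <- word112 (k :: c) | x > 1].
    by rewrite subseq_filter ab_w /= a_gt1 (ltn_trans a_gt1).
  rewrite /= filter_cat filter_map_succ // filter_nseq1 // cats0.
  have -> : [:: a; a; b] = map succn [:: a.-1; a.-1; b.-1].
    by rewrite /= !prednK // (leq_ltn_trans _ lt_ab).
  rewrite subseq_map_succ => ab_c; case/contains112P: IHc.
  by exists a.-1, b.-1; split=> //; lia.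
have a1 : a = 1 by lia.
move: ab_w; rewrite a1 /= => /subseq_cat_notin ab_w.
have /ab_w/mem_subseq/(_ b) : 1 \notin map succn (word112 c).
  by rewrite mem_map_succ mem_word112.
rewrite !inE eqxx orbT mem_nseq => /(_ isT)/andP[_ /eqP b1]; lia.
Qed.

(** Each letter above 1 enters only once, as a new maximum; all other insertions are 1s. *)
Lemma count_word122 (c : seq nat) (b : nat) :
  1 < b -> count_mem b (word122 c) <= 1.
Proof.
move=> b_gt1; elim: c => //= k c IHc.
rewrite count_cat /= count_nseq /= (ltn_eqF b_gt1) mul0n addn0.
case: eqP => [<-|_]; last by rewrite addn0.
by rewrite (count_memPn _) // mem_word122 ltnn andbF.
Qed.

Lemma avoids_word122 (c : seq nat) : avoids (word122 c) [:: 1; 2; 2].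
Proof.
apply/contains122P => -[a [b [lt_ab ab_w]]].
have : a \in word122 c by apply: (mem_subseq ab_w); rewrite mem_head.
rewrite mem_word122 => /andP[a_gt0 _].
have := leq_trans (leq_count_subseq (pred1 b) ab_w) (count_word122 c (leq_ltn_trans a_gt0 lt_ab)).
by rewrite /= eqxx (ltn_eqF lt_ab).
Qed.

(** * Every avoider belongs to its family *)

Lemma subword_avoids112 (w : seq nat) (x y : nat) :
  avoids w [:: 1; 1; 2] -> subseq [:: x; x; y] w -> y <= x.
Proof.
by move=> /contains112P w_av xy_w; rewrite leqNgt; apply/negP => lt_xy; apply: w_av; exists x, y.
Qed.

(** Once a second 1 has appeared, a larger letter would complete a 112, so only 1s can follow. *)
Lemma avoids112_tail (v : seq nat) :
  all (leq 1) v -> avoids (1 :: v) [:: 1; 1; 2] ->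
  exists u k, v = u ++ nseq k 1 /\ 1 \notin u.
Proof.
move=> v_gt0 v_av; case: (boolP (1 \in v)) => [v1|v1]; last first.
  by exists v, 0; rewrite cats0.
exists (take (index 1 v) v), (size (drop (index 1 v) v)).
rewrite in_take // ltnn; split=> //.
suff /all_pred1P <- : all (pred1 1) (drop (index 1 v) v) by rewrite cat_take_drop.
rewrite drop_index //=; apply/allP => y y_v /=.
have y_gt0 : 0 < y by apply: (allP v_gt0); apply: mem_drop y_v.
suff : y <= 1 by lia.
apply: (subword_avoids112 v_av) => /=.
rewrite -[v in subseq _ v](cat_take_drop (index 1 v)) drop_index //.
by apply: subseq_trans (suffix_subseq _ _); rewrite /= sub1seq.
Qed.

(** Strong induction on length: strip the leading 1 and the final block of 1s, then lower the
    remaining letters by one. *)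
Lemma word112_surj (w : seq nat) :
  is_rgf w -> avoids w [:: 1; 1; 2] -> exists c, w = word112 c.
Proof.
have [n] := ubnP (size w); elim: n w => // n IHn [|x v] lt_vn w_rgf w_av.
  by exists [::].
have x1 := rgf_head w_rgf; subst x; have v_gt0 : all (leq 1) v by have /andP[] := rgf_gt0 w_rgf.
have [u [k [v_eq u1]]] := avoids112_tail v_gt0 w_av; subst v.
move: v_gt0; rewrite all_cat => /andP[u_gt0 _].
have u_eq : u = map succn (map predn u).
  rewrite -map_comp -[LHS]map_id; apply/eq_in_map => y y_u /=.
  by rewrite prednK //; apply: (allP u_gt0).
have u'_rgf : is_rgf (map predn u).
  rewrite -rgf_map_succ -u_eq; move: w_rgf; rewrite -cat_cons rgf_nseq1 => -> /=.
  rewrite all_map; apply/allP => y y_u /=.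
  have /= := allP u_gt0 _ y_u; have : y != 1 by apply: contraNneq u1 => <-.
  lia.
have u'_av : avoids (map predn u) [:: 1; 1; 2].
  apply/contains112P => -[a [b [lt_ab]]]; rewrite -subseq_map_succ -u_eq /= => ab_u.
  have := subword_avoids112 (x := a.+1) (y := b.+1) w_av.
  rewrite ltnS leqNgt lt_ab => /(_ _)/notF; apply.
  apply: subseq_trans ab_u _; apply: subseq_trans (subseq_cons _ _).
  exact: prefix_subseq.
have [|c u'_eq] := IHn _ _ u'_rgf u'_av.
  by move: lt_vn; rewrite /= size_cat size_map; lia.
by exists (k :: c); rewrite /= -u'_eq -u_eq.
Qed.

Lemma word122_surj (w : seq nat) :
  is_rgf w -> avoids w [:: 1; 2; 2] -> exists c, w = word122 c.
Proof.
elim/last_ind: w => [_ _|w x IHw]; first by exists [::].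
rewrite rgf_rcons => /andP[w_rgf /andP[x_gt0 x_le]] wx_av.
have [//||c w_eq] := IHw.
  apply: contra wx_av => /contains122P[a [b [lt_ab ab_w]]]; apply/contains122P.
  by exists a, b; split=> //; apply: subseq_trans ab_w (subseq_rcons _ _).
move: x_le; rewrite {}w_eq bigmax_word122 leq_eqVlt in wx_av *.
(* A new maximum opens a block with no extra 1s. *)
move=> /predU1P[->|]; first by exists (0 :: c); rewrite /= cats1.
rewrite ltnS => x_le; have [x1|x_neq1] := eqVneq x 1.
  (* A further 1 lengthens the last block, which exists because [x] is at most [size c]. *)
  case: c x_le {wx_av IHw w_rgf} => [|k c] x_le; first by move: x_le => /=; lia.
  by exists (k.+1 :: c); rewrite x1 /= rcons_cat rcons_cons rcons_nseq1.
(* Any other letter has already occurred after the leading 1, so repeating it creates a 122. *)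
case/contains122P: wx_av; exists 1, x; split; first by lia.
rewrite -cats1 -[[:: 1; x; x]]/([:: 1; x] ++ [:: x]) cat_subseq //.
have : x \in word122 c by rewrite mem_word122 x_gt0.
case: (word122 c) (rgf_word122 c) => [|y v] // c_rgf.
by rewrite (rgf_head c_rgf) inE (negbTE x_neq1) /= sub1seq.
Qed.

(** * The vector is determined by the word *)

(** The head [k] is the number of 1s after the first letter, and the letters above 1 give back the
    shifted smaller word. *)
Lemma word112_inj : injective word112.
Proof.
elim=> [|k c IHc] [|k' c'] //= [eq_w].
have gt0 d : all (leq 1) (word112 d) by apply: rgf_gt0; apply: rgf_word112.
have no1 d : count_mem 1 (map succn (word112 d)) = 0.
  by apply/count_memPn; rewrite mem_map_succ mem_word112.
congr (_ :: _).
  by have := congr1 (count_mem 1) eq_w; rewrite !count_cat !no1 !count_nseq !mul1n.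
apply: IHc; apply: (inj_map succn_inj).
have := congr1 (filter (fun x => x > 1)) eq_w.
by rewrite !filter_cat !filter_nseq1 // !cats0 !filter_map_succ.
Qed.

(** The maximum gives the length of the vector, and the position of the maximal letter shows where
    to split the word. *)
Lemma word122_inj : injective word122.
Proof.
elim=> [|k c IHc] [|k' c'] eq_w //.
- by have := congr1 size eq_w; rewrite /= size_cat /= addnS.
- by have := congr1 size eq_w; rewrite /= size_cat /= addnS.
have [eq_sz] : size (k :: c) = size (k' :: c') by rewrite -!bigmax_word122 eq_w.
move: eq_w; rewrite /= -eq_sz => eq_w.
have idx d j : size d = size c ->
    index (size c).+1 (word122 d ++ (size c).+1 :: nseq j 1) = size (word122 d).
  by move=> sz_d; rewrite index_cat mem_word122 sz_d ltnn andbF /= eqxx addn0.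
have /eqP := eq_w; rewrite eqseq_cat => [/andP[/eqP/IHc-> /eqP[]]|].
  by move=> /(congr1 size); rewrite !size_nseq => ->.
by rewrite -(idx c k) // -(idx c' k') // eq_w.
Qed.

(** * The statistics on both families *)

Lemma eq_distinct (s t : seq nat) : s =i t -> distinct s = distinct t.
Proof. by move=> eq_st; apply/perm_size/perm_undup. Qed.

Lemma distinct_iota (s : seq nat) (a n : nat) : s =i iota a n -> distinct s = n.
Proof.
by move=> /eq_distinct->; rewrite /distinct undup_id ?iota_uniq ?size_iota.
Qed.

Lemma distinct_map_succ (s : seq nat) : distinct (map succn s) = distinct s.
Proof. by rewrite /distinct undup_map_inj ?size_map //; apply: succn_inj. Qed.

Lemma distinct_cons_notin (x : nat) (s : seq nat) :
  x \notin s -> distinct (x :: s) = (distinct s).+1.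
Proof. by rewrite /distinct /= => /negbTE->. Qed.

(** Serves [lb] and [ls] at once: they look only leftwards, so an appended letter leaves earlier
    terms unchanged. *)
Lemma sum_prefix_rcons (G : seq nat -> nat -> nat) (w : seq nat) (x : nat) :
  \sum_(j < size (rcons w x)) G (take j (rcons w x)) (nth 0 (rcons w x) j)
    = \sum_(j < size w) G (take j w) (nth 0 w j) + G w x.
Proof.
rewrite size_rcons big_ord_recr /= nth_rcons ltnn eqxx -cats1 take_size_cat //.
congr (_ + _); apply: eq_bigr => j _.
by rewrite takel_cat ?(ltnW (ltn_ord j)) // nth_cat ltn_ord.
Qed.

Lemma lb_rcons (w : seq nat) (x : nat) :
  lb (rcons w x) = lb w + distinct [seq y <- w | y > x].
Proof. exact: (sum_prefix_rcons (fun s x => distinct [seq y <- s | y > x])). Qed.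

Lemma ls_rcons (w : seq nat) (x : nat) :
  ls (rcons w x) = ls w + distinct [seq y <- w | y < x].
Proof. exact: (sum_prefix_rcons (fun s x => distinct [seq y <- s | y < x])). Qed.

Lemma rb_cons (x : nat) (w : seq nat) :
  rb (x :: w) = distinct [seq y <- w | y > x] + rb w.
Proof. by rewrite /rb big_ord_recl /= drop0. Qed.

Lemma lb_nil : lb [::] = 0. Proof. exact: big_ord0. Qed.
Lemma ls_nil : ls [::] = 0. Proof. exact: big_ord0. Qed.
Lemma rb_nil : rb [::] = 0. Proof. exact: big_ord0. Qed.

Lemma lb_cat_nseq1 (w : seq nat) (k : nat) :
  lb (w ++ nseq k 1) = lb w + k * distinct [seq y <- w | y > 1].
Proof.
elim: k => [|k IHk]; first by rewrite cats0 addn0.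
rewrite -rcons_nseq1 -rcons_cat lb_rcons IHk filter_cat filter_nseq1 // cats0.
lia.
Qed.

Lemma ls_cat_nseq1 (w : seq nat) (k : nat) :
  all (leq 1) w -> ls (w ++ nseq k 1) = ls w.
Proof.
move=> w_gt0; elim: k => [|k IHk]; first by rewrite cats0.
rewrite -rcons_nseq1 -rcons_cat ls_rcons IHk.
rewrite (eq_in_filter (a2 := pred0)) ?filter_pred0 ?addn0 // => y.
rewrite mem_cat mem_nseq => /orP[/(allP w_gt0)|] /=; lia.
Qed.

Lemma lb_map_succ (w : seq nat) : lb (1 :: map succn w) = lb w.
Proof.
elim/last_ind: w => [|w x IHw].
  by rewrite -[1 :: _]/(rcons [::] 1) lb_rcons lb_nil.
by rewrite map_rcons -rcons_cons !lb_rcons IHw /= filter_map distinct_map_succ.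
Qed.

(** The leading 1 is one new smaller value to the left of every shifted letter. *)
Lemma ls_map_succ (w : seq nat) :
  all (leq 1) w -> ls (1 :: map succn w) = ls w + size w.
Proof.
elim/last_ind: w => [|w x IHw].
  by rewrite -[1 :: _]/(rcons [::] 1) ls_rcons.
rewrite all_rcons => /andP[x_gt0 w_gt0].
rewrite map_rcons -rcons_cons !ls_rcons IHw // size_rcons /= ltnS x_gt0.
rewrite filter_map distinct_cons_notin ?distinct_map_succ; first by rewrite addnAC !addnS.
rewrite mem_map_succ mem_filter /=; apply/negP => /andP[_ /(allP w_gt0)].
by [].
Qed.

Lemma rb_nseq1 (k : nat) : rb (nseq k 1) = 0.
Proof. by elim: k => [|k IHk]; rewrite ?rb_nil //= rb_cons filter_nseq1. Qed.

Lemma rb_map_succ (w : seq nat) (k : nat) : rb (map succn w ++ nseq k 1) = rb w.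
Proof.
elim: w => [|x w IHw]; first by rewrite rb_nseq1 rb_nil.
rewrite /= !rb_cons IHw filter_cat filter_nseq1 // cats0.
by rewrite filter_map distinct_map_succ.
Qed.

(** [m] is one new larger value to the right of every letter of [w]; the appended letters contribute
    nothing themselves. *)
Lemma rb_cat_max (w : seq nat) (m k : nat) :
  0 < m -> all (fun x => 0 < x < m) w -> rb (w ++ m :: nseq k 1) = rb w + size w.
Proof.
move=> m_gt0; elim: w => [_|x w IHw] /=.
  by rewrite rb_cons rb_nseq1 rb_nil filter_nseq1.
move=> /andP[/andP[x_gt0 lt_xm] w_lt]; rewrite !rb_cons IHw //.
rewrite filter_cat /= lt_xm filter_nseq1 //.
rewrite (eq_distinct (t := m :: [seq y <- w | y > x])); last first.
  by move=> y; rewrite mem_cat !inE orbC.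
rewrite distinct_cons_notin; first by lia.
by rewrite mem_filter; apply/negP => /andP[_ /(allP w_lt)]; rewrite ltnn andbF.
Qed.

(** Consing [k] adds equal amounts on both sides: [k * size c] to [lb], the old word length
    [size c + sumn c] to the second pair, and [size c] to the third. *)
Lemma stat_words (c : seq nat) :
  [/\ lb (word112 c) = lb (word122 c), ls (word112 c) = rb (word122 c)
    & rb (word112 c) = ls (word122 c)].
Proof.
elim: c => [|k c [IHlb IHls IHrb]] /=; first by rewrite lb_nil ls_nil rb_nil.
have gt0_112 : all (leq 1) (word112 c) by apply: rgf_gt0; apply: rgf_word112.
have gt0_122 : all (leq 1) (word122 c) by apply: rgf_gt0; apply: rgf_word122.
split.
- rewrite -cat_cons lb_cat_nseq1 lb_map_succ -cat_rcons lb_cat_nseq1 lb_rcons.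
  rewrite (@distinct_iota _ 2 (size c)); last first.
    move=> y; rewrite mem_filter inE mem_map_succ mem_word112 mem_iota; lia.
  rewrite (@distinct_iota _ 0 0); last first.
    move=> y; rewrite mem_filter mem_word122 mem_iota; lia.
  rewrite (@distinct_iota _ 2 (size c)); last first.
    move=> y; rewrite mem_filter mem_rcons inE mem_word122 mem_iota; lia.
  by rewrite IHlb addn0.
- rewrite -cat_cons ls_cat_nseq1; last by rewrite /= all_map; apply/allP.
  rewrite ls_map_succ // rb_cat_max ?IHls ?size_word112 ?size_word122 //.
  by apply/allP => y; rewrite mem_word122; lia.
- rewrite rb_cons rb_map_succ -cat_rcons ls_cat_nseq1; last first.
    by rewrite all_rcons.
  rewrite ls_rcons IHrb addnC; congr (_ + _).
  rewrite (@distinct_iota _ 2 (size c)); last first.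
    move=> y; rewrite mem_filter mem_cat mem_map_succ mem_word112 mem_nseq.
    by rewrite mem_iota; lia.
  rewrite (@distinct_iota _ 1 (size c)) // => y.
  by rewrite mem_filter mem_word122 mem_iota; lia.
Qed.

(** * Reindexing both sums by the same vectors *)

(** Length and entries are capped at [n] to make the enumeration finite; [size c + sumn c] is the
    length of either word of [c]. *)
Definition count_vectors (n : nat) : seq (seq nat) :=
  undup (flatten
    [seq [seq c <- [seq map val (tval t) | t : m.-tuple 'I_n.+1] |
           size c + sumn c == n] | m <- iota 0 n.+1]).

Lemma mem_count_vectors (n : nat) (c : seq nat) :
  (c \in count_vectors n) = (size c + sumn c == n).
Proof.
rewrite mem_undup; apply/flatten_mapP/eqP => [[m _]|c_n].
  by rewrite mem_filter => /andP[/eqP].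
exists (size c); first by rewrite mem_iota; lia.
rewrite mem_filter c_n eqxx /=; apply/mapP.
(* Each entry is at most [sumn c], hence at most [n], so [inord] preserves it. *)
exists (map_tuple inord (in_tuple c)); first exact: mem_enum.
rewrite -map_comp map_id_in // => x x_c /=; rewrite inordK // ltnS -c_n.
apply: leq_trans (leq_addl _ _); elim: c x_c {c_n} => //= y c IHc.
rewrite inE => /predU1P[->|/IHc]; lia.
Qed.

(** The avoiders and the encoded words form duplicate-free lists with the same members, hence
    permutations of each other. *)
Lemma sum_avoiders (A : comNzRingType) (n : nat) (v : seq nat)
    (wordc : seq nat -> seq nat) (f : seq nat -> A) :
  injective wordc -> (forall c, size (wordc c) = size c + sumn c) ->
  (forall w, is_rgf w && avoids w v <-> exists c, w = wordc c) ->
  (\sum_(w in R_ n v) f (word w) = \sum_(c <- count_vectors n) f (wordc c))%R.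
Proof.
move=> wordc_inj size_wordc wordcP.
rewrite -big_enum -(big_map (@word n) xpredT f) -(big_map wordc xpredT f).
apply/perm_big/uniq_perm => [||w].
- by rewrite map_inj_uniq ?enum_uniq //; apply: word_inj.
- by rewrite map_inj_uniq ?undup_uniq.
apply/mapP/mapP => [[u]|[c c_n ->]].
  rewrite mem_enum inE => /wordcP[c u_c] ->; exists c => //.
  by rewrite mem_count_vectors -size_wordc -u_c /word size_map size_tuple.
have rc : is_rgf (wordc c) && avoids (wordc c) v by apply/wordcP; exists c.
have [u u_c] : exists u : n.-tuple 'I_n.+1, word u = wordc c.
  apply: rgf_in_range; first by case/andP: rc.
  by apply/eqP; rewrite size_wordc -mem_count_vectors.
by exists u; rewrite ?u_c // mem_enum inE u_c.
Qed.

Theorem theorem2p12 (A : comNzRingType) (n : nat) (q r s : A) :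
  F n [:: 1; 1; 2] q r s 1%R = F n [:: 1; 2; 2] q s r 1%R.
Proof.
rewrite /F.
rewrite (sum_avoiders _ (fun w => q ^+ lb w * r ^+ ls w * s ^+ rb w * 1 ^+ rs w)%R
  word112_inj size_word112) => [|w]; last first.
  split=> [/andP[]|[c ->]]; first exact: word112_surj.
  by rewrite rgf_word112 avoids_word112.
rewrite (sum_avoiders _ (fun w => q ^+ lb w * s ^+ ls w * r ^+ rb w * 1 ^+ rs w)%R
  word122_inj size_word122) => [|w]; last first.
  split=> [/andP[]|[c ->]]; first exact: word122_surj.
  by rewrite rgf_word122 avoids_word122.
apply: eq_bigr => c _; have [-> -> ->] := stat_words c.
by rewrite !expr1n !mulr1 mulrAC.
Qed.
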